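(* Let $M$ be a smooth manifold of dimension $n$, let $\sigma\colon M\to\mathbb X_{n+1}$ be an admissible immersion and let $g=\sigma^*\langle\cdot,\cdot\rangle$ be the induced complex metric. Let $\nabla$ be the Levi-Civita connection of $g$, $R^M$ the curvature tensor of $g$, and $\Psi$ the shape operator associated to $\sigma$. Then for any (local) $g$-orthonormal frame $(X_i)_{i=1}^n$ of $\mathbb C TM$ with corresponding coframe $(\theta^i)_{i=1}^n$, writing $\Psi=\sum_i\Psi^i\otimes X_i$, the following equations hold: 1) $d^\nabla\Psi\equiv 0$; 2) $R^M(X_i,X_j,\cdot,\cdot)-\Psi^i\wedge\Psi^j=-\theta^i\wedge\theta^j$ for all $i,j$.
   Context: $\mathbb X_{n+1}=\{z\in\mathbb C^{n+2}\mid\sum z_i^2=-1\}$ with the holomorphic Riemannian metric $\langle\cdot,\cdot\rangle$ obtained by restricting $\langle z,w\rangle_0=\sum z_iw_i$ to $T_z\mathbb X_{n+1}=z^\perp$. Manifolds are connected; $\mathbb CTM=TM\otimes_{\mathbb R}\mathbb C$. A complex metric on $M$ is a smooth section $g$ of symmetric $\mathbb C$-bilinear forms on $\mathbb CTM$, non-degenerate at every point. Its Levi-Civita connection is the unique connection $\nabla$ on $\mathbb CTM$ that is torsion-free and compatible with $g$; $R(X,Y)Z=\nabla_X\nabla_YZ-\nabla_Y\nabla_XZ-\nabla_{[X,Y]}Z$ and $R(X,Y,Z,T)=-g(R(X,Y)Z,T)$. For a smooth immersion $\sigma\colon M\to\mathbb X_{n+1}$, $d\sigma$ is extended $\mathbb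 C$-linearly to $\mathbb CTM$, and $\sigma$ is admissible if $\sigma^*\langle\cdot,\cdot\rangle$ (the $\mathbb C$-bilinear form $(X,Y)\mapsto\langle d\sigma(X),d\sigma(Y)\rangle$) is a complex metric. A local normal vector field is a local smooth section $\nu$ of $\sigma^*T\mathbb X_{n+1}$ with $\langle\nu,\nu\rangle=1$, orthogonal to $d\sigma(\mathbb CTM)$; it is unique up to sign. The shape operator $\Psi$ is the $\mathbb C$-linear bundle endomorphism of $\mathbb CTM$ with $g(\Psi(X),Y)=\langle\overline\nabla_XY,\nu\rangle$, where $\overline\nabla$ is the pull-back (extended $\mathbb C$-linearly) of the Levi-Civita connection of $\mathbb X_{n+1}$; equivalently, regarding $\nu$ as a $\mathbb C^{n+2}$-valued function, $d\nu(X)=-d\sigma(\Psi(X))$. It is $g$-self-adjoint and defined (locally) up to sign. The exterior covariant derivative is $(d^\nabla\Psi)(X,Y)=\nabla_X(\Psi(Y))-\nabla_Y(\Psi(X))-\Psi([X,Y])$. Wedge: $(\alpha\wedge\beta)(Z,W)=\alpha(Z)\beta(W)-\alpha(W)\beta(Z)$. *)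

(* Defs.v *)
(* The field of real numbers is an abstract [R : realType], and that of complex
   numbers is [R[i]]. *)
From HB Require Import structures.
From mathcomp Require Import all_boot all_order all_algebra complex.
From mathcomp Require Import all_classical all_reals all_analysis.
From mathcomp Require Import ring.

Set Implicit Arguments.
Unset Strict Implicit.
Unset Printing Implicit Defensive.

Import Order.TTheory GRing.Theory Num.Theory numFieldNormedType.Exports.

Local Open Scope classical_set_scope.
Local Open Scope ring_scope.

(* [Ck k V f]: on the open set [V] of R^n, the partial derivatives of [f] of
   order at most [k] exist and are continuous. *)
Fixpoint Ck (R : realType) (n k : nat) (V : set 'rV[R]_n)
    (f : 'rV[R]_n -> R) : Prop :=
  (forall x, V x -> {for x, continuous f}) /\
  match k with
  | 0 => True
  | k'.+1 => forall i : 'I_n,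
      (forall x, V x -> derivable f x (delta_mx 0 i)) /\
      Ck k' V (derive f ^~ (delta_mx 0 i))
  end.

Definition euclid_smooth (R : realType) (n : nat) (V : set 'rV[R]_n)
    (f : 'rV[R]_n -> R) : Prop :=
  forall k, Ck k V f.

(* A chart is a homeomorphism from an open subset of [M] onto an open subset of
   R^n; outside of these sets the two functions are irrelevant. *)
Record chart (R : realType) (n : nat) (M : topologicalType) := Chart {
  chart_dom : set M;
  chart_img : set 'rV[R]_n;
  chart_map : M -> 'rV[R]_n;
  chart_inv : 'rV[R]_n -> M;
  chart_dom_open : open chart_dom;
  chart_img_open : open chart_img;
  chart_mapP : forall p, chart_dom p -> chart_img (chart_map p);
  chart_invP : forall x, chart_img x -> chart_dom (chart_inv x);
  chart_mapK : forall p, chart_dom p -> chart_inv (chart_map p) = p;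
  chart_invK : forall x, chart_img x -> chart_map (chart_inv x) = x;
  chart_map_cont : forall p, chart_dom p -> {for p, continuous chart_map};
  chart_inv_cont : forall x, chart_img x -> {for x, continuous chart_inv} }.

Definition chart_compat (R : realType) (n : nat) (M : topologicalType)
    (c d : chart R n M) : Prop :=
  forall i : 'I_n,
    euclid_smooth (chart_img c `&` chart_inv c @^-1` chart_dom d)
      (fun x => chart_map d (chart_inv c x) 0 i).

Record manifold (R : realType) (n : nat) := Manifold {
  manifold_carrier :> topologicalType;
  manifold_hausdorff : hausdorff_space manifold_carrier;
  manifold_second_countable : @second_countable manifold_carrier;
  manifold_connected : connected [set: manifold_carrier];
  atlas : set (chart R n manifold_carrier);
  atlas_cover : forall p, exists2 c, atlas c & chart_dom c p;
  atlas_compat : forall c d, atlas c -> atlas d -> chart_compat c d }.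

Section TangentSpace.
Variables (R : realType) (n : nat) (M : manifold R n).
Local Notation C := R[i].

(* Smoothness on an open set [U]; only the values of [f] on [U] matter. *)
Definition smooth (U : set M) (f : M -> R) : Prop :=
  forall c, atlas c ->
    euclid_smooth (chart_img c `&` chart_inv c @^-1` U) (f \o chart_inv c).

Definition smooth_near (p : M) (f : M -> R) : Prop :=
  exists2 U, open_nbhs p U & smooth U f.

Definition csmooth (U : set M) (f : M -> C) : Prop :=
  smooth U (fun q => complex.Re (f q)) /\ smooth U (fun q => complex.Im (f q)).

Definition csmooth_near (p : M) (f : M -> C) : Prop :=
  exists2 U, open_nbhs p U & csmooth U f.

(* T_pM: the derivations at [p] of the algebra of functions that are smooth near
   [p]. They are extended by 0 to all functions, so that equality of tangent
   vectors is Leibniz equality. *)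
Definition tangent (p : M) : set ((M -> R) -> R) :=
  [set v | [/\ forall (a : R) (f g : M -> R),
                 smooth_near p f -> smooth_near p g ->
                 v (fun q => a * f q + g q) = a * v f + v g,
               forall f g : M -> R,
                 smooth_near p f -> smooth_near p g ->
                 v (fun q => f q * g q) = v f * g p + f p * v g &
               forall f : M -> R, ~ smooth_near p f -> v f = 0]].

(* The fibre of the complexification TM (x) C at [p]: [v = u + i w] with [u] and
   [w] in T_pM. *)
Definition ctangent (p : M) : {pred (M -> R) -> C^o} :=
  fun v => `[< tangent p (fun f => complex.Re (v f)) /\
               tangent p (fun f => complex.Im (v f)) >].

Lemma tangent0 p : tangent p (fun=> 0).
Proof. by split=> *; rewrite ?(mulr0, mul0r, addr0). Qed.

Lemma tangent_comb p (a b : R) u v w : tangent p u -> tangent p v ->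
  tangent p w -> tangent p (fun f => a * u f + b * v f + w f).
Proof.
move=> [u1 u2 u3] [v1 v2 v3] [w1 w2 w3]; split.
- by move=> c f g sf sg; rewrite u1// v1// w1//; ring.
- by move=> f g sf sg; rewrite u2// v2// w2//; ring.
- by move=> f sf; rewrite u3// v3// w3// !mulr0 !addr0.
Qed.

Let ReMD (a x y : C) : complex.Re (a * x + y) =
  complex.Re a * complex.Re x + (- complex.Im a) * complex.Im x + complex.Re y.
Proof. by case: a x y => [? ?] [? ?] [? ?] /=; rewrite mulNr. Qed.

Let ImMD (a x y : C) : complex.Im (a * x + y) =
  complex.Im a * complex.Re x + complex.Re a * complex.Im x + complex.Im y.
Proof.
by case: a x y => [? ?] [? ?] [? ?] /=; congr (_ + _); rewrite addrC.
Qed.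

Lemma ctangent_submod_closed p : submod_closed (ctangent p).
Proof.
split; first by apply/asboolP; split; exact: tangent0.
move=> a u v /asboolP[ru iu] /asboolP[rv iv]; apply/asboolP; split.
  rewrite (_ : (fun f => _) = fun f => complex.Re a * complex.Re (u f) +
    (- complex.Im a) * complex.Im (u f) + complex.Re (v f)).
    exact: tangent_comb.
  by apply/funext => f; exact: ReMD.
rewrite (_ : (fun f => _) = fun f => complex.Im a * complex.Re (u f) +
  complex.Re a * complex.Im (u f) + complex.Im (v f)).
  exact: tangent_comb.
by apply/funext => f; exact: ImMD.
Qed.

HB.instance Definition _ p :=
  GRing.isSubmodClosed.Build C ((M -> R) -> C^o) (ctangent p)
    (ctangent_submod_closed p).

Record CT (p : M) := CTangent {
  ct_val :> (M -> R) -> C^o;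
  ct_valP : ct_val \in ctangent p }.

HB.instance Definition _ p := [isSub for @ct_val p].
HB.instance Definition _ p := [Choice of CT p by <:].
HB.instance Definition _ p := [SubChoice_isSubLmodule of CT p by <:].

End TangentSpace.

Section VectorFields.
Variables (R : realType) (n : nat) (M : manifold R n).
Local Notation C := R[i].

(* The C-linear extension of a vector of TM (x) C to complex-valued functions. *)
Definition cder (p : M) (v : CT p) (f : M -> C) : C :=
  v (fun q => complex.Re (f q)) + 'i%C * v (fun q => complex.Im (f q)).

Definition is_real_vector (p : M) (v : CT p) : Prop :=
  forall f : M -> R, complex.Im (v f) = 0.

(* Arbitrary sections of CTM; a section over an open set [U] is represented by a
   global one, whose values outside of [U] are irrelevant. *)
Definition field := forall p : M, CT p.

Definition smooth_field (U : set M) (X : field) : Prop :=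
  forall (W : set M) (f : M -> R), open W -> W `<=` U -> smooth W f ->
    csmooth W (fun p => X p f).

Definition smooth_field_near (p : M) (X : field) : Prop :=
  exists2 U, open_nbhs p U & smooth_field U X.

(* [X, Y] f = X (Y f) - Y (X f) for [f] smooth near [p]. The result is a tangent
   vector as soon as [X] and [Y] are smooth near [p]; [insubd] gives the junk
   value 0 otherwise. *)
Definition bracket (X Y : field) : field := fun p =>
  insubd (0 : CT p) (fun f : M -> R =>
    if `[< smooth_near p f >]
    then cder (X p) (fun q => Y q f) - cder (Y p) (fun q => X q f) else 0).

Definition bilinear_field := forall p : M, CT p -> CT p -> C.

Definition is_complex_metric (g : bilinear_field) : Prop :=
  [/\ forall p (a : C) (u v w : CT p),
        g p (a *: u + v) w = a * g p u w + g p v w,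
      forall p (u v : CT p), g p u v = g p v u,
      forall p (u : CT p), (forall v, g p u v = 0) -> u = 0 &
      forall U X Y, open U -> smooth_field U X -> smooth_field U Y ->
        csmooth U (fun p => g p (X p) (Y p))].

(* Connections on CTM, as the operators [(v, Y) |-> nabla_v Y] acting on vectors
   [v] at [p] and sections [Y] that are smooth near [p]. *)
Definition connection := forall p : M, CT p -> field -> CT p.

Definition is_connection (D : connection) : Prop :=
  [/\ forall p (Y : field) (a : C) (u v : CT p), smooth_field_near p Y ->
        D p (a *: u + v) Y = a *: D p u Y + D p v Y,
      forall p (v : CT p) (Y Z : field),
        smooth_field_near p Y -> smooth_field_near p Z ->
        D p v (fun q => Y q + Z q) = D p v Y + D p v Z,
      forall p (v : CT p) (f : M -> C) (Y : field),
        csmooth_near p f -> smooth_field_near p Y ->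
        D p v (fun q => f q *: Y q) = cder v f *: Y p + f p *: D p v Y &
      forall U X Y, open U -> smooth_field U X -> smooth_field U Y ->
        smooth_field U (fun p => D p (X p) Y)].

Definition torsion_free (D : connection) : Prop :=
  forall U X Y p, open U -> smooth_field U X -> smooth_field U Y -> U p ->
    D p (X p) Y - D p (Y p) X = bracket X Y p.

Definition metric_compatible (g : bilinear_field) (D : connection) : Prop :=
  forall p (v : CT p) (Y Z : field),
    smooth_field_near p Y -> smooth_field_near p Z ->
    cder v (fun q => g q (Y q) (Z q)) = g p (D p v Y) (Z p) + g p (Y p) (D p v Z).

Definition is_levi_civita (g : bilinear_field) (D : connection) : Prop :=
  [/\ is_connection D, torsion_free D & metric_compatible g D].

Definition curvature (D : connection) (X Y Z : field) : field := fun p =>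
  D p (X p) (fun q => D q (Y q) Z) - D p (Y p) (fun q => D q (X q) Z)
  - D p (bracket X Y p) Z.

Definition curvature4 (g : bilinear_field) (D : connection) (X Y Z T : field) :
    M -> C :=
  fun p => - g p (curvature D X Y Z p) (T p).

Definition endo_field := forall p : M, {linear CT p -> CT p}.

Definition smooth_endo (U : set M) (Psi : endo_field) : Prop :=
  forall W X, open W -> W `<=` U -> smooth_field W X ->
    smooth_field W (fun p => Psi p (X p)).

Definition ext_cov_deriv (D : connection) (Psi : endo_field) (X Y : field) :
    field := fun p =>
  D p (X p) (fun q => Psi q (Y q)) - D p (Y p) (fun q => Psi q (X q))
  - Psi p (bracket X Y p).

Definition covector_field := forall p : M, {scalar CT p}.

Definition wedge (alpha beta : covector_field) (Z W : field) : M -> C :=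
  fun p => alpha p (Z p) * beta p (W p) - alpha p (W p) * beta p (Z p).

Definition is_frame (U : set M) (X : 'I_n -> field) : Prop :=
  (forall i, smooth_field U (X i)) /\
  forall p, U p -> forall v : CT p,
    exists! a : 'I_n -> C, v = \sum_i a i *: X i p.

Definition is_orthonormal (g : bilinear_field) (U : set M) (X : 'I_n -> field) :
    Prop :=
  forall p, U p -> forall i j, g p (X i p) (X j p) = (i == j)%:R.

Definition is_coframe (U : set M) (X : 'I_n -> field)
    (theta : 'I_n -> covector_field) : Prop :=
  forall p, U p -> forall i j, theta i p (X j p) = (i == j)%:R.

Definition is_decomposition (U : set M) (X : 'I_n -> field) (Psi : endo_field)
    (Psic : 'I_n -> covector_field) : Prop :=
  forall p, U p -> forall v : CT p, Psi p v = \sum_i Psic i p v *: X i p.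

End VectorFields.

(* The bilinear form <z, w>_0 = \sum_i z_i w_i on C^m. *)
Definition cdot (R : realType) (m : nat) (z w : 'rV[R[i]]_m) : R[i] :=
  \sum_i z 0 i * w 0 i.

(* The space X_m, as a subset of C^(m + 1). *)
Definition quadric (R : realType) (m : nat) : set 'rV[R[i]]_m.+1 :=
  [set z | cdot z z = -1].

Definition quadric_tangent (R : realType) (m : nat) (z : 'rV[R[i]]_m.+1) :
    set 'rV[R[i]]_m.+1 :=
  [set w | cdot z w = 0].

Section Immersions.
Variables (R : realType) (n : nat) (M : manifold R n).
Local Notation C := R[i].
Local Notation E := 'rV[C]_n.+2.
Implicit Types (sigma nu s : M -> E) (U : set M).

Definition vsmooth U s : Prop := forall k, csmooth U (fun p => s p 0 k).

(* The derivative of a vector-valued function, extended C-linearly to CTM. *)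
Definition vder (p : M) (v : CT p) s : E := \row_k cder v (fun q => s q 0 k).

Definition pullback_form sigma : bilinear_field M :=
  fun p u v => cdot (vder u sigma) (vder v sigma).

Definition is_immersion sigma : Prop :=
  [/\ vsmooth setT sigma,
      forall p, quadric (sigma p) &
      forall p (u : CT p), is_real_vector u -> vder u sigma = 0 -> u = 0].

Definition is_admissible sigma : Prop :=
  is_immersion sigma /\ is_complex_metric (pullback_form sigma).

Definition is_normal_field sigma U nu : Prop :=
  vsmooth U nu /\
  forall p, U p ->
    [/\ quadric_tangent (sigma p) (nu p),
        cdot (nu p) (nu p) = 1 &
        forall v : CT p, cdot (vder v sigma) (nu p) = 0].

(* The pull-back to sigma^*TX_(n+1) of the Levi-Civita connection of X_(n+1): the
   latter is the orthogonal projection, from C^(n+2) onto z^perp, of the flat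
   connection; as <z, z> = -1, this projection is [w |-> w + <w, z> z]. *)
Definition pullback_connection sigma (p : M) (v : CT p) s : E :=
  vder v s + cdot (vder v s) (sigma p) *: sigma p.

Definition is_shape_operator sigma U nu (Psi : endo_field M) : Prop :=
  smooth_endo U Psi /\
  forall p, U p -> forall (v : CT p) (Y : field M), smooth_field_near p Y ->
    pullback_form sigma (Psi p v) (Y p) =
    cdot (pullback_connection sigma v (fun q => vder (Y q) sigma)) (nu p).

End Immersions.

(* Main.v *)
Require Import Defs.
From mathcomp Require Import all_boot all_order all_algebra complex.
From mathcomp Require Import all_classical all_reals all_analysis.
From mathcomp Require Import ring.

Set Implicit Arguments.
Unset Strict Implicit.
Unset Printing Implicit Defensive.

Import GRing.Theory Num.Theory numFieldNormedType.Exports.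
Local Open Scope classical_set_scope.
Local Open Scope ring_scope.

(** Regard [dsigma Y], [nu] and [sigma] as functions with values in [C^(n + 2)].
    Flat differentiation of such functions commutes up to the bracket:
    [[X, Y] s = X (Y s) - Y (X s)] ([vder_bracket]). This single identity, applied
    to [sigma], [nu] and [dsigma Z], gives respectively the symmetry of the second
    fundamental form, the Codazzi equation and the Gauss equation.

    To read off components, note that at each point the vectors [dsigma X_i], [nu]
    and [sigma] form an orthogonal basis of [C^(n + 2)], of squares 1, 1 and -1
    ([adapted_basis_eq0]). Hence the Gauss formula
      [D_u (dsigma Y) = dsigma (nabla_u Y) + g (Psi u, Y) nu + g (u, Y) sigma]
    ([gauss_formula]): its normal part is the definition of [Psi], its [sigma] part
    comes from differentiating [<dsigma Y, sigma> = 0], and its tangential part is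
    [nabla_u Y] by uniqueness of the Levi-Civita connection ([tangential_nabla]).
    In the same way [D_u nu = - dsigma (Psi u)] ([weingarten_formula]).

    Substituting these formulas in the identity for [nu], the [nu]
    components cancel by the symmetry of [g] and the [sigma] components by the
    self-adjointness of [Psi]; what remains is
    [dsigma (d^nabla Psi (Y, Z)) = 0] ([codazzi_equation]). In the identity for
    [dsigma Z], the tangential component expresses the curvature by products of
    [g (Psi _, _)] and of [g (_, _)] ([gauss_equation]). On an orthonormal frame
    [theta^i = g (X_i, _)] and [Psi^i = g (Psi X_i, _)], which turns these products
    into the wedge products of the statement.

    All of this is coordinate-free: tangent vectors are derivations, and all that
    is needed about smooth functions is that they form a sheaf of algebras on
    which derivations act locally ([tangent_local]). *)

(** * Functions of class C^k on open subsets of R^n *)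

Section EuclideanSmoothness.
Variables (R : realType) (n : nat).
Implicit Types (V W : set 'rV[R]_n) (f g : 'rV[R]_n -> R) (k : nat).

Lemma open_near_eq V f g x : open V -> {in V, f =1 g} -> V x ->
  \forall y \near x, f y = g y.
Proof.
move=> oV fg Vx; have : nbhs x V by exact: open_nbhs_nbhs.
by apply: filterS => y Vy; apply: fg; rewrite inE.
Qed.

Lemma eq_continuous_at V f g x : open V -> {in V, f =1 g} -> V x ->
  {for x, continuous f} -> {for x, continuous g}.
Proof.
move=> oV fg Vx cf; have E := open_near_eq oV fg Vx.
change (g @ x --> g x); rewrite -(fg x) ?inE//.
exact: cvg_trans (near_eq_cvg E) cf.
Qed.

Lemma eq_Ck k V f g : open V -> {in V, f =1 g} -> Ck k V f -> Ck k V g.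
Proof.
move=> oV; elim: k f g => [|k IH] f g fg [cf df]; split;
  try by [|move=> x Vx; exact: (eq_continuous_at oV fg Vx (cf x Vx))].
move=> i; have [d C] := df i; split.
  move=> x Vx; apply: near_eq_derivable (d x Vx); exact: open_near_eq Vx.
apply: IH C => x; rewrite inE => Vx.
by apply: near_eq_derive; exact: open_near_eq Vx.
Qed.

Lemma sub_Ck k V W f : W `<=` V -> Ck k V f -> Ck k W f.
Proof.
move=> WV; elim: k f => [|k IH] f [cf df]; split=> //.
- by move=> x /WV; exact: cf.
- by move=> x /WV; exact: cf.
- by move=> i; have [d /IH] := df i; split=> // x /WV; exact: d.
Qed.

Lemma Ck_pred k V f : Ck k.+1 V f -> Ck k V f.
Proof.
elim: k f => [|k IH] f [cf df]; split=> // i.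
by have [d /IH] := df i; split.
Qed.

Lemma Ck_cst k V (c : R) : Ck k V (cst c).
Proof.
elim: k c => [|k IH] c; split=> //; try by move=> x _; exact: cst_continuous.
move=> i; split; first by move=> x _; exact: derivable_cst.
have -> : derive (cst c : 'rV[R]_n -> R) ^~ (delta_mx 0 i) = cst 0.
  by apply/funext => x; rewrite derive_cst.
exact: IH.
Qed.

Lemma CkD k V f g : open V -> Ck k V f -> Ck k V g -> Ck k V (f + g).
Proof.
move=> oV; elim: k f g => [|k IH] f g [cf df] [cg dg]; split=> //;
  try by move=> x Vx; apply: continuousD; [exact: cf|exact: cg].
move=> i; have [Df Cf] := df i; have [Dg Cg] := dg i; split.
  by move=> x Vx; apply: derivableD; [exact: Df|exact: Dg].
apply: eq_Ck (IH _ _ Cf Cg) => // x; rewrite inE => Vx.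
by rewrite deriveD//; [exact: Df|exact: Dg].
Qed.

Lemma CkM k V f g : open V -> Ck k V f -> Ck k V g -> Ck k V (f * g).
Proof.
move=> oV; elim: k f g => [|k IH] f g Kf Kg.
  case: Kf Kg => [cf df] [cg dg]; split=> //.
  by move=> x Vx; apply: continuousM; [exact: cf|exact: cg].
have [Jf Jg] := (Ck_pred Kf, Ck_pred Kg).
case: Kf Kg => [cf df] [cg dg]; split.
  by move=> x Vx; apply: continuousM; [exact: cf|exact: cg].
move=> i; have [Df Cf] := df i; have [Dg Cg] := dg i; split.
  by move=> x Vx; apply: derivableM; [exact: Df|exact: Dg].
apply: eq_Ck (CkD oV (IH _ _ Jf Cg) (IH _ _ Jg Cf)) => // x.
by rewrite inE => Vx; rewrite deriveM//; [exact: Df|exact: Dg].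
Qed.

End EuclideanSmoothness.

(** * Smooth functions on a manifold, and locality of derivations *)

Section SmoothFunctions.
Variables (R : realType) (n : nat) (M : manifold R n).
Implicit Types (U V W : set M) (f g : M -> R) (p : M).

Lemma chart_preimage_open (c : chart R n M) U : open U ->
  open (chart_img c `&` chart_inv c @^-1` U).
Proof.
move=> oU; rewrite openE => x [cx Ux].
have nc : nbhs x (chart_img c).
  by apply: open_nbhs_nbhs; split=> //; exact: chart_img_open.
apply: filterI => //; apply: (chart_inv_cont cx).
exact: open_nbhs_nbhs.
Qed.

Lemma eq_smooth U f g : open U -> {in U, f =1 g} -> smooth U f -> smooth U g.
Proof.
move=> oU fg sf c ac k; apply: eq_Ck (sf c ac k).
  exact: chart_preimage_open.
by move=> x /set_mem[cx Ux] /=; apply: fg; rewrite inE.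
Qed.

Lemma sub_smooth U W f : W `<=` U -> smooth U f -> smooth W f.
Proof.
move=> WU sf c ac k; apply: sub_Ck (sf c ac k) => x [cx /WU Ux].
by split.
Qed.

Lemma smooth_cst U (a : R) : smooth U (fun=> a).
Proof. by move=> c ac k; exact: Ck_cst. Qed.

Lemma smoothD U f g : open U -> smooth U f -> smooth U g ->
  smooth U (fun q => f q + g q).
Proof.
move=> oU sf sg c ac k.
exact: CkD (chart_preimage_open oU) (sf c ac k) (sg c ac k).
Qed.

Lemma smoothM U f g : open U -> smooth U f -> smooth U g ->
  smooth U (fun q => f q * g q).
Proof.
move=> oU sf sg c ac k.
exact: CkM (chart_preimage_open oU) (sf c ac k) (sg c ac k).
Qed.

Lemma smoothZ U (a : R) f : open U -> smooth U f -> smooth U (fun q => a * f q).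
Proof. by move=> oU sf; apply: smoothM => //; exact: smooth_cst. Qed.

Lemma smoothB U f g : open U -> smooth U f -> smooth U g ->
  smooth U (fun q => f q - g q).
Proof.
move=> oU sf sg; rewrite (_ : (fun q => _) = fun q => f q + (-1) * g q).
  by apply: smoothD => //; exact: smoothZ.
by apply/funext => q; rewrite mulN1r.
Qed.

Lemma smooth_nearP U p f : open U -> U p -> smooth U f -> smooth_near p f.
Proof. by move=> oU Up sf; exists U. Qed.

(** A derivation kills any [h] that vanishes on an open neighbourhood [V] of
    [p]. No bump function is needed: the indicator of the complement of [V] is
    smooth near [p], being constant there, and [h] is the product of [h] with
    that indicator, two functions that both vanish at [p]. *)
Lemma tangent_local p (v : (M -> R) -> R) V f g : tangent p v ->
  open V -> V p -> {in V, f =1 g} -> smooth_near p f -> v f = v g.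
Proof.
move=> [vL vM v0] oV Vp fg [W [oW Wp] sf].
have oVW : open (V `&` W) by exact: openI.
have VWp : (V `&` W) p by [].
have fgVW : {in V `&` W, f =1 g}.
  by move=> q /set_mem[Vq _]; apply: fg; rewrite inE.
have sf' : smooth (V `&` W) f by apply: sub_smooth sf.
have sg : smooth (V `&` W) g by exact: eq_smooth sf'.
pose h q := (-1) * g q + f q.
have hV q : V q -> h q = 0 by move=> Vq; rewrite /h fg ?inE// mulN1r addNr.
have sh : smooth_near p h.
  apply: (smooth_nearP oVW) => //; apply: smoothD => //; exact: smoothZ.
pose chi q : R := (\1_(~` V)) q.
have chiV q : V q -> chi q = 0.
  by move=> Vq; rewrite /chi indicE memNset//= => /(_ Vq).
have schi : smooth_near p chi.
  apply: (smooth_nearP oV) => //; apply: (@eq_smooth _ (fun=> 0)) => //.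
    by move=> q /set_mem /chiV.
  exact: smooth_cst.
have hE : h = fun q => chi q * h q.
  apply/funext => q; have [Vq|nVq] := pselect (V q).
    by rewrite hV// mulr0.
  by rewrite /chi indicE mem_set//= mul1r.
have : v h = 0.
  by rewrite hE vM// chiV// hV// mul0r mulr0 addr0.
rewrite /h vL; first by rewrite mulN1r addrC => /subr0_eq.
- by exact: smooth_nearP sg.
- by exact: smooth_nearP sf'.
Qed.

End SmoothFunctions.

(** * Derivatives of complex-valued functions *)

Section ComplexDerivations.
Variables (R : realType) (n : nat) (M : manifold R n).
Local Notation C := R[i].
Implicit Types (U W : set M) (p : M).

Lemma complex_ext (x y : C) : complex.Re x = complex.Re y ->
  complex.Im x = complex.Im y -> x = y.
Proof. by case: x y => [? ?] [? ?] /= -> ->. Qed.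

Lemma sub_csmooth U W (f : M -> C) : W `<=` U -> csmooth U f -> csmooth W f.
Proof.
by move=> WU [sr si]; split; [apply: sub_smooth sr|apply: sub_smooth si].
Qed.

Lemma csmooth_real U (f : M -> R) : smooth U f ->
  csmooth U (fun q => (f q)%:C%C).
Proof. by move=> sf; split => //=; exact: smooth_cst. Qed.

Lemma csmooth_cst U (a : C) : csmooth U (fun=> a).
Proof. by split; exact: smooth_cst. Qed.

Lemma csmoothD U (f g : M -> C) : open U -> csmooth U f -> csmooth U g ->
  csmooth U (fun q => f q + g q).
Proof.
move=> oU [rf jf] [rg jg]; split.
  rewrite (_ : (fun q => _) = fun q => complex.Re (f q) + complex.Re (g q)).
    exact: smoothD.
  by apply/funext => q; case: (f q) (g q) => [? ?] [? ?].
rewrite (_ : (fun q => _) = fun q => complex.Im (f q) + complex.Im (g q)).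
  exact: smoothD.
by apply/funext => q; case: (f q) (g q) => [? ?] [? ?].
Qed.

Lemma csmoothM U (f g : M -> C) : open U -> csmooth U f -> csmooth U g ->
  csmooth U (fun q => f q * g q).
Proof.
move=> oU [rf jf] [rg jg]; split.
  rewrite (_ : (fun q => _) = fun q => complex.Re (f q) * complex.Re (g q) -
    complex.Im (f q) * complex.Im (g q)).
    by apply: smoothB => //; exact: smoothM.
  by apply/funext => q; case: (f q) (g q) => [? ?] [? ?].
rewrite (_ : (fun q => _) = fun q => complex.Re (f q) * complex.Im (g q) +
    complex.Im (f q) * complex.Re (g q)).
  by apply: smoothD => //; exact: smoothM.
by apply/funext => q; case: (f q) (g q) => [? ?] [? ?].
Qed.

Lemma csmooth_sum U (I : finType) (F : I -> M -> C) : open U ->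
  (forall i, csmooth U (F i)) -> csmooth U (fun q => \sum_i F i q).
Proof.
move=> oU sF.
suff H (r : seq I) : csmooth U (fun q => \sum_(i <- r) F i q) by exact: H.
elim: r => [|i r IH].
  by rewrite (_ : (fun q => _) = fun=> 0); [exact: csmooth_cst|
    apply/funext => q; rewrite big_nil].
rewrite (_ : (fun q => _) = fun q => F i q + \sum_(j <- r) F j q).
  exact: csmoothD.
by apply/funext => q; rewrite big_cons.
Qed.

Section AtPoint.
Variables (U : set M) (p : M).
Hypotheses (oU : open U) (Up : U p).

Lemma ct_Re (v : CT p) : tangent p (fun f => complex.Re (v f)).
Proof. by have /asboolP[] := ct_valP v. Qed.

Lemma ct_Im (v : CT p) : tangent p (fun f => complex.Im (v f)).
Proof. by have /asboolP[] := ct_valP v. Qed.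

Lemma ct_local (v : CT p) (f g : M -> R) : {in U, f =1 g} -> smooth U f ->
  v f = v g.
Proof.
move=> fg sf; have nf := smooth_nearP oU Up sf.
apply: complex_ext.
  exact: (tangent_local (ct_Re v) oU Up fg nf).
exact: (tangent_local (ct_Im v) oU Up fg nf).
Qed.

Lemma ct_linear (v : CT p) (a : R) (f g : M -> R) :
  smooth_near p f -> smooth_near p g ->
  v (fun q => a * f q + g q) = a%:C%C * v f + v g.
Proof.
move=> sf sg; have [/(_ a _ _ sf sg) r _ _] := ct_Re v.
have [/(_ a _ _ sf sg) i _ _] := ct_Im v.
apply: complex_ext; rewrite ?r ?i; case: (v f) (v g) => [? ?] [? ?] /=; ring.
Qed.

Lemma ct_leibniz (v : CT p) (f g : M -> R) :
  smooth_near p f -> smooth_near p g ->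
  v (fun q => f q * g q) = v f * (g p)%:C%C + (f p)%:C%C * v g.
Proof.
move=> sf sg; have [_ /(_ _ _ sf sg) r _] := ct_Re v.
have [_ /(_ _ _ sf sg) i _] := ct_Im v.
apply: complex_ext; rewrite ?r ?i; case: (v f) (v g) => [? ?] [? ?] /=; ring.
Qed.

(** The constant 1 is its own square, so [v 1 = v 1 + v 1]. *)
Lemma ct_cst (v : CT p) (a : R) : v (fun=> a) = 0.
Proof.
have s1 b : smooth_near p (fun=> b) 
    by apply: (smooth_nearP oU Up); exact: smooth_cst.
have v1 : v (fun=> 1) = 0.
  have /= := ct_leibniz v (s1 1) (s1 1).
  rewrite mulr1 !mul1r mulr1 => /eqP; rewrite -subr_eq0 opprD addrA subrr add0r.
  by rewrite oppr_eq0 => /eqP.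
have v0 : v (fun=> 0) = 0.
  have := ct_linear v (-1) (s1 1) (s1 1).
  by rewrite mulr1 addNr v1 mulr0 addr0.
have := ct_linear v a (s1 1) (s1 0).
by rewrite v1 v0 mulr1 mulr0 !addr0.
Qed.

Lemma cder_real (v : CT p) (f : M -> R) : cder v (fun q => (f q)%:C%C) = v f.
Proof. by rewrite /cder /= ct_cst mulr0 addr0. Qed.

Lemma cder_cst (v : CT p) (a : C) : cder v (fun=> a) = 0.
Proof. by rewrite /cder !ct_cst mulr0 addr0. Qed.

Lemma cder_local (v : CT p) (f g : M -> C) : {in U, f =1 g} -> csmooth U f ->
  cder v f = cder v g.
Proof.
move=> fg [sr si]; rewrite /cder; congr (_ + _ * _).
  by apply: ct_local => // q Uq; rewrite fg.
by apply: ct_local => // q Uq; rewrite fg.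
Qed.

Lemma ctD (v : CT p) (f g : M -> R) : smooth U f -> smooth U g ->
  v (fun q => f q + g q) = v f + v g.
Proof.
move=> /(smooth_nearP oU Up) sf /(smooth_nearP oU Up) sg.
have := ct_linear v 1 sf sg.
by rewrite (_ : 1%:C%C = 1)// mul1r => <-; congr (ct_val v _);
  apply/funext => q; rewrite mul1r.
Qed.

Lemma ctB (v : CT p) (f g : M -> R) : smooth U f -> smooth U g ->
  v (fun q => f q - g q) = v f - v g.
Proof.
move=> /(smooth_nearP oU Up) sf /(smooth_nearP oU Up) sg.
have := ct_linear v (-1) sg sf.
rewrite (_ : (-1)%:C%C = -1); last by apply: complex_ext => //=; rewrite oppr0.
rewrite mulN1r addrC => <-; congr (ct_val v _).
by apply/funext => q; rewrite mulN1r addrC.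
Qed.

Lemma ctM (v : CT p) (f g : M -> R) : smooth U f -> smooth U g ->
  v (fun q => f q * g q) = v f * (g p)%:C%C + (f p)%:C%C * v g.
Proof.
by move=> sf sg; apply: ct_leibniz; exact: (smooth_nearP oU Up).
Qed.

Lemma cderD (v : CT p) (f g : M -> C) : csmooth U f -> csmooth U g ->
  cder v (fun q => f q + g q) = cder v f + cder v g.
Proof.
move=> [rf jf] [rg jg]; rewrite /cder.
under eq_fun do rewrite (raddfD (@complex.Re R)).
under [X in _ + _ * ct_val v X]eq_fun do rewrite raddfD.
by rewrite !ctD//; ring.
Qed.

Lemma cderM (v : CT p) (f g : M -> C) : csmooth U f -> csmooth U g ->
  cder v (fun q => f q * g q) = cder v f * g p + f p * cder v g.
Proof.
move=> [rf jf] [rg jg].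
have split_ri (z : C) : z = (complex.Re z)%:C%C + 'i%C * (complex.Im z)%:C%C.
  by apply: complex_ext; case: z => a b /=; ring.
have ii : 'i%C * 'i%C = -1 :> C by apply: complex_ext => /=; ring.
rewrite /cder.
have -> : (fun q => complex.Re (f q * g q)) = fun q =>
    complex.Re (f q) * complex.Re (g q) - complex.Im (f q) * complex.Im (g q).
  by apply/funext => q; case: (f q) (g q) => [? ?] [? ?].
have -> : (fun q => complex.Im (f q * g q)) = fun q =>
    complex.Re (f q) * complex.Im (g q) + complex.Im (f q) * complex.Re (g q).
  by apply/funext => q; case: (f q) (g q) => [? ?] [? ?].
rewrite ctB ?ctD ?ctM//; try exact: smoothM.
rewrite [in RHS](split_ri (f p)) [in RHS](split_ri (g p)).
set a := (complex.Re (f p))%:C%C; set b := (complex.Im (f p))%:C%C.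
set c := (complex.Re (g p))%:C%C; set d := (complex.Im (g p))%:C%C.
rewrite !mulrDl !mulrDr.
have J x y : 'i%C * x * ('i%C * y) = - (x * y) :> C.
  by rewrite mulrACA ii mulN1r.
rewrite !J; ring.
Qed.

Lemma cder_sum (v : CT p) (I : finType) (F : I -> M -> C) :
  (forall i, csmooth U (F i)) ->
  cder v (fun q => \sum_i F i q) = \sum_i cder v (F i).
Proof.
move=> sF.
suff H (r : seq I) : csmooth U (fun q => \sum_(i <- r) F i q) /\
    cder v (fun q => \sum_(i <- r) F i q) = \sum_(i <- r) cder v (F i).
  by have [] := H (index_enum I).
elim: r => [|i r [s E]].
  rewrite (_ : (fun q => _) = fun=> 0); last first.
    by apply/funext => q; rewrite big_nil.
  by rewrite big_nil cder_cst; split => //; exact: csmooth_cst.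
rewrite (_ : (fun q => _) = fun q => F i q + \sum_(j <- r) F j q); last first.
  by apply/funext => q; rewrite big_cons.
by rewrite cderD// big_cons E; split => //; exact: csmoothD.
Qed.

Lemma cder_linear (a : C) (u v : CT p) (f : M -> C) :
  cder (a *: u + v) f = a * cder u f + cder v f.
Proof.
have E h : (a *: u + v : CT p) h = a * u h + v h by [].
by rewrite /cder !E; ring.
Qed.

End AtPoint.

End ComplexDerivations.

(** * The bracket of vector fields *)

Section Bracket.
Variables (R : realType) (n : nat) (M : manifold R n).
Local Notation C := R[i].
Implicit Types (U W : set M) (p : M) (X Y : field M).

Lemma sub_smooth_field U W X : W `<=` U -> smooth_field U X -> smooth_field W X.
Proof. by move=> WU sX V f oV VW; apply: sX => //; exact: subset_trans WU. Qed.

Lemma smooth_field_nearP U p X : open U -> U p -> smooth_field U X ->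
  smooth_field_near p X.
Proof. by move=> oU Up sX; exists U. Qed.

Lemma smooth_ct U X (f : M -> R) : open U -> smooth_field U X -> smooth U f ->
  csmooth U (fun q => X q f).
Proof. by move=> oU sX; exact: sX. Qed.

Lemma csmooth_cder U X (f : M -> C) : open U -> smooth_field U X ->
  csmooth U f -> csmooth U (fun q => cder (X q) f).
Proof.
move=> oU sX [sr si]; apply: csmoothD => //; first exact: smooth_ct.
by apply: csmoothM => //; [exact: csmooth_cst|exact: smooth_ct].
Qed.

Lemma ctangent_of_complex p (w : (M -> R) -> C) :
  (forall (a : R) (f g : M -> R), smooth_near p f -> smooth_near p g ->
     w (fun q => a * f q + g q) = a%:C%C * w f + w g) ->
  (forall f g : M -> R, smooth_near p f -> smooth_near p g ->
     w (fun q => f q * g q) = w f * (g p)%:C%C + (f p)%:C%C * w g) ->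
  (forall f : M -> R, ~ smooth_near p f -> w f = 0) ->
  w \in ctangent p.
Proof.
move=> wL wM w0; apply/asboolP; split; split.
- move=> a f g sf sg; rewrite wL//.
  by case: (w f) (w g) => [? ?] [? ?] /=; ring.
- move=> f g sf sg; rewrite wM//.
  by case: (w f) (w g) => [? ?] [? ?] /=; ring.
- by move=> f sf; rewrite w0.
- move=> a f g sf sg; rewrite wL//.
  by case: (w f) (w g) => [? ?] [? ?] /=; ring.
- move=> f g sf sg; rewrite wM//.
  by case: (w f) (w g) => [? ?] [? ?] /=; ring.
- by move=> f sf; rewrite w0.
Qed.

Definition field_commutator X Y p (f : M -> R) : C :=
  cder (X p) (fun q => Y q f) - cder (Y p) (fun q => X q f).

Lemma field_commutator_linear U X Y p (a : R) (f g : M -> R) : open U -> U p ->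
  smooth_field U X -> smooth_field U Y -> smooth U f -> smooth U g ->
  field_commutator X Y p (fun q => a * f q + g q) =
  a%:C%C * field_commutator X Y p f + field_commutator X Y p g.
Proof.
move=> oU Up sX sY sf sg; rewrite /field_commutator.
have E (v : CT p) Z : smooth_field U Z ->
    cder v (fun q => Z q (fun r => a * f r + g r)) =
    a%:C%C * cder v (fun q => Z q f) + cder v (fun q => Z q g).
  move=> sZ; have sa := csmooth_cst U (a%:C%C).
  have [sZf sZg] := (smooth_ct oU sZ sf, smooth_ct oU sZ sg).
  have saf : csmooth U (fun q => a%:C%C * Z q f) by exact: csmoothM.
  transitivity (cder v (fun q => a%:C%C * Z q f + Z q g)).
    symmetry; apply: (cder_local oU Up); last exact: csmoothD.
    move=> q /set_mem Uq.
    by rewrite ct_linear//; exact: (smooth_nearP oU).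
  by rewrite (cderD oU)// (cderM oU)// (cder_cst oU)// mul0r add0r.
by rewrite !E//; ring.
Qed.

(** The cross terms [X f * Y g + Y f * X g] of [X (Y (f g))] are symmetric in [X]
    and [Y], so they cancel in the commutator. *)
Lemma field_commutator_leibniz U X Y p (f g : M -> R) : open U -> U p ->
  smooth_field U X -> smooth_field U Y -> smooth U f -> smooth U g ->
  field_commutator X Y p (fun q => f q * g q) =
  field_commutator X Y p f * (g p)%:C%C + (f p)%:C%C * field_commutator X Y p g.
Proof.
move=> oU Up sX sY sf sg; rewrite /field_commutator.
have [rf rg] := (csmooth_real sf, csmooth_real sg).
have E (v : CT p) Z : smooth_field U Z ->
    cder v (fun q => Z q (fun r => f r * g r)) =
    cder v (fun q => Z q f) * (g p)%:C%C + Z p f * v g +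
    (v f * Z p g + (f p)%:C%C * cder v (fun q => Z q g)).
  move=> sZ; have [sZf sZg] := (smooth_ct oU sZ sf, smooth_ct oU sZ sg).
  transitivity (cder v (fun q => Z q f * (g q)%:C%C + (f q)%:C%C * Z q g)).
    symmetry; apply: (cder_local oU Up).
      by move=> q /set_mem Uq; rewrite (ctM oU Uq).
    by apply: csmoothD => //; exact: csmoothM.
  rewrite (cderD oU)//; try exact: csmoothM.
  by rewrite !(cderM oU)// !(cder_real oU Up).
by rewrite !E//; ring.
Qed.

(** The commutator is a tangent vector, so that the default value in the
    definition of the bracket is not reached. As the functions to be
    differentiated are smooth only near [p], the verification takes place on a
    neighbourhood smaller than [U], depending on them. *)
Lemma bracketE U X Y p (f : M -> R) : open U -> U p ->
  smooth_field U X -> smooth_field U Y -> smooth_near p f ->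
  bracket X Y p f = field_commutator X Y p f.
Proof.
move=> oU Up sX sY nf; rewrite /bracket.
set w := fun f : M -> R => if _ then _ else _.
suff w_ct : w \in ctangent p.
  by rewrite -[LHS]/(val (insubd _ _) f) insubdK// /w asboolT.
have shrink (W : set M) : open_nbhs p W ->
    [/\ open (U `&` W), (U `&` W) p, smooth_field (U `&` W) X &
        smooth_field (U `&` W) Y].
  move=> [oW Wp]; split => //; first exact: openI.
    by apply: sub_smooth_field sX => q [].
  by apply: sub_smooth_field sY => q [].
apply: ctangent_of_complex.
- move=> a g h [V [oV Vp] sg] [W [oW Wp] sh].
  have [//|oN Np NX NY] := shrink (V `&` W); first by split => //; exact: openI.
  have Ng : smooth (U `&` (V `&` W)) g by apply: sub_smooth sg => q [_ []].
  have Nh : smooth (U `&` (V `&` W)) h by apply: sub_smooth sh => q [_ []].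
  rewrite /w !asboolT; try by [exact: (smooth_nearP oN)|
    apply: (smooth_nearP oN) => //; apply: smoothD => //; exact: smoothZ].
  exact: (field_commutator_linear a oN Np).
- move=> g h [V [oV Vp] sg] [W [oW Wp] sh].
  have [//|oN Np NX NY] := shrink (V `&` W); first by split => //; exact: openI.
  have Ng : smooth (U `&` (V `&` W)) g by apply: sub_smooth sg => q [_ []].
  have Nh : smooth (U `&` (V `&` W)) h by apply: sub_smooth sh => q [_ []].
  rewrite /w !asboolT; try by [exact: (smooth_nearP oN)|
    apply: (smooth_nearP oN) => //; exact: smoothM].
  exact: (field_commutator_leibniz oN Np).
- by move=> g sg; rewrite /w asboolF.
Qed.

Lemma cder_bracket U X Y p (f : M -> C) : open U -> U p ->
  smooth_field U X -> smooth_field U Y -> csmooth U f ->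
  cder (bracket X Y p) f =
  cder (X p) (fun q => cder (Y q) f) - cder (Y p) (fun q => cder (X q) f).
Proof.
move=> oU Up sX sY [sr si].
have E (v : CT p) Z : smooth_field U Z -> cder v (fun q => cder (Z q) f) =
    cder v (fun q => Z q (fun r => complex.Re (f r))) +
    'i%C * cder v (fun q => Z q (fun r => complex.Im (f r))).
  move=> sZ; have [zr zi] := (smooth_ct oU sZ sr, smooth_ct oU sZ si).
  have ci := csmooth_cst U ('i%C : C).
  have -> : (fun q => cder (Z q) f) = fun q =>
      Z q (fun r => complex.Re (f r)) +
      'i%C * Z q (fun r => complex.Im (f r)) by [].
  rewrite (cderD oU)//; last exact: csmoothM.
  by rewrite (cderM oU)// (cder_cst oU)// mul0r add0r.
rewrite !E// [in LHS]/cder !(bracketE oU Up sX sY).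
- by rewrite /field_commutator; ring.
- exact: smooth_nearP si.
- exact: smooth_nearP sr.
Qed.

End Bracket.

(** * The bilinear form on C^m *)

Section VectorValued.
Variables (R : realType) (m : nat).
Local Notation C := R[i].
Local Notation E := 'rV[C]_m.
Implicit Types (x y z : E).

Lemma cdotC x y : cdot x y = cdot y x.
Proof. by apply: eq_bigr => k _; rewrite mulrC. Qed.

Lemma cdotDl x y z : cdot (x + y) z = cdot x z + cdot y z.
Proof. by rewrite -big_split; apply: eq_bigr => k _; rewrite mxE mulrDl. Qed.

Lemma cdotZl (a : C) x y : cdot (a *: x) y = a * cdot x y.
Proof. by rewrite mulr_sumr; apply: eq_bigr => k _; rewrite mxE mulrA. Qed.

Lemma cdotNl x y : cdot (- x) y = - cdot x y.
Proof. by rewrite -scaleN1r cdotZl mulN1r. Qed.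

Lemma cdotBl x y z : cdot (x - y) z = cdot x z - cdot y z.
Proof. by rewrite cdotDl cdotNl. Qed.

(** The [m] vectors have an invertible Gram matrix, so they form a basis of
    [C^m]; as [cdot] is non-degenerate, only 0 is orthogonal to all of them. *)
Lemma cdot_orthobasis_eq0 (I : finType) (b : I -> E) (d : I -> C) (w : E) :
  #|I| = m -> (forall i, d i != 0) ->
  (forall i j, cdot (b i) (b j) = if i == j then d i else 0) ->
  (forall i, cdot w (b i) = 0) -> w = 0.
Proof.
move=> cI d0 bb wb; case: m / cI in b w bb wb *.
pose A : 'M[C]_#|I| := \matrix_i b (enum_val i).
have Gram : A *m A^T = diag_mx (\row_i d (enum_val i)).
  apply/matrixP => i j; rewrite !mxE.
  transitivity (cdot (b (enum_val i)) (b (enum_val j))).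
    by apply: eq_bigr => k _; rewrite !mxE.
  by rewrite bb (inj_eq enum_val_inj); case: eqVneq; rewrite ?mulr1n ?mulr0n.
have uA : A^T \in unitmx.
  have : \det (A *m A^T) != 0.
    by rewrite Gram det_diag; apply/prodf_neq0 => i _; rewrite mxE.
  by rewrite det_mulmx mulf_eq0 negb_or unitmxE unitfE => /andP[].
apply: (can_inj (mulmxK uA)); rewrite mul0mx.
apply/rowP => i; rewrite !mxE -[RHS](wb (enum_val i)).
by apply: eq_bigr => k _; rewrite !mxE.
Qed.

End VectorValued.

(** * Derivatives of vector-valued functions *)

Section VectorDerivative.
Variables (R : realType) (n : nat) (M : manifold R n).
Local Notation C := R[i].
Local Notation E := 'rV[C]_n.+2.
Variables (U : set M).
Hypothesis (oU : open U).
Implicit Types (p : M) (s t : M -> E) (f : M -> C) (X Y : field M).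

Lemma sub_vsmooth (W : set M) s : W `<=` U -> vsmooth U s -> vsmooth W s.
Proof. by move=> WU sU k; exact: sub_csmooth (sU k). Qed.

Lemma vsmoothD s t : vsmooth U s -> vsmooth U t ->
  vsmooth U (fun q => s q + t q).
Proof.
move=> ss st k; rewrite (_ : (fun q => _) = fun q => s q 0 k + t q 0 k).
  exact: csmoothD.
by apply/funext => q; rewrite mxE.
Qed.

Lemma vsmoothZ f s : csmooth U f -> vsmooth U s ->
  vsmooth U (fun q => f q *: s q).
Proof.
move=> sf ss k; rewrite (_ : (fun q => _) = fun q => f q * s q 0 k).
  exact: csmoothM.
by apply/funext => q; rewrite mxE.
Qed.

Lemma vsmooth_vder X s : smooth_field U X -> vsmooth U s ->
  vsmooth U (fun q => vder (X q) s).
Proof.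
move=> sX ss k.
rewrite (_ : (fun q => _) = fun q => cder (X q) (fun r => s r 0 k)).
  exact: csmooth_cder.
by apply/funext => q; rewrite mxE.
Qed.

Variable (p : M).
Hypothesis (Up : U p).
Implicit Types (u v : CT p).

Lemma vder_linear (a : C) u v s :
  vder (a *: u + v) s = a *: vder u s + vder v s.
Proof. by apply/rowP => k; rewrite !mxE cder_linear. Qed.

Lemma vderD v s t : vsmooth U s -> vsmooth U t ->
  vder v (fun q => s q + t q) = vder v s + vder v t.
Proof.
move=> ss st; apply/rowP => k; rewrite !mxE -(cderD oU)//.
by congr cder; apply/funext => q; rewrite mxE.
Qed.

Lemma vderZ v f s : csmooth U f -> vsmooth U s ->
  vder v (fun q => f q *: s q) = cder v f *: s p + f p *: vder v s.
Proof.
move=> sf ss; apply/rowP => k; rewrite !mxE -(cderM oU)//.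
by congr cder; apply/funext => q; rewrite mxE.
Qed.

Lemma vder_local v s t : {in U, s =1 t} -> vsmooth U s -> vder v s = vder v t.
Proof.
move=> st ss; apply/rowP => k; rewrite !mxE; apply: (cder_local oU) => //.
by move=> q Uq; rewrite st.
Qed.

Lemma cder_cdot v s t : vsmooth U s -> vsmooth U t ->
  cder v (fun q => cdot (s q) (t q)) =
  cdot (vder v s) (t p) + cdot (s p) (vder v t).
Proof.
move=> ss st; rewrite (cder_sum oU)//; last by move=> k; exact: csmoothM.
rewrite -big_split; apply: eq_bigr => k _ /=.
by rewrite (cderM oU)// !mxE.
Qed.

Lemma vder_bracket X Y s :
  smooth_field U X -> smooth_field U Y -> vsmooth U s ->
  vder (bracket X Y p) s =
  vder (X p) (fun q => vder (Y q) s) - vder (Y p) (fun q => vder (X q) s).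
Proof.
move=> sX sY ss; apply/rowP => k; rewrite !mxE (cder_bracket oU)//.
by congr (_ - _); congr cder; apply/funext => q; rewrite mxE.
Qed.

End VectorDerivative.

(** * Frames *)

Section Frames.
Variables (R : realType) (n : nat) (M : manifold R n).
Local Notation C := R[i].
Local Notation E := 'rV[C]_n.+2.
Implicit Types (U : set M) (p : M) (X : 'I_n -> field M) (s : M -> E).

Lemma smooth_field_comb U X (a : 'I_n -> C) : open U ->
  (forall i, smooth_field U (X i)) ->
  smooth_field U (fun p => \sum_i a i *: X i p).
Proof.
move=> oU sX W f oW WU sf.
rewrite (_ : (fun p => _) = fun p => \sum_i a i * X i p f).
  by apply: csmooth_sum => // i; apply: csmoothM => //;
    [exact: csmooth_cst|exact: sX].
apply/funext => p.
by rewrite (big_morph (fun v : CT p => v f) (id1 := 0) (op1 := +%R)).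
Qed.

(** A vector at [p] extends to a smooth field, with constant components in the
    frame; so identities that are tensorial can be checked on fields. *)
Lemma frame_extend U X p (v : CT p) : open U -> is_frame U X -> U p ->
  exists2 V : field M, smooth_field U V & V p = v.
Proof.
move=> oU [sX spanX] Up; have [a [-> _]] := spanX p Up v.
by exists (fun q => \sum_i a i *: X i q) => //; exact: smooth_field_comb.
Qed.

Lemma vderBl p (u v : CT p) s : vder (u - v) s = vder u s - vder v s.
Proof.
by rewrite addrC -scaleN1r vder_linear scaleN1r addrC.
Qed.

Lemma pullback_form_combl s p (a : 'I_n -> C) (u : 'I_n -> CT p) (v : CT p) :
  pullback_form s (\sum_i a i *: u i) v = \sum_i a i * pullback_form s (u i) v.
Proof.
have v0 : vder (0 : CT p) s = 0 by rewrite -(subrr (0 : CT p)) vderBl subrr.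
have D (w w' : CT p) (b : C) : vder (b *: w + w') s = b *: vder w s + vder w' s.
  exact: vder_linear.
elim/big_rec2: _ => [|i x y _ <-].
  by rewrite /pullback_form v0 -(scale0r (0 : E)) cdotZl mul0r.
by rewrite /pullback_form D cdotDl cdotZl.
Qed.

End Frames.

(** * Structure equations of an immersion into the quadric *)

Section Hypersurface.
Variables (R : realType) (n : nat) (M : manifold R n).
Local Notation C := R[i].
Variables (sigma : M -> 'rV[C]_n.+2) (nabla : connection M).
Variables (U : set M) (nu : M -> 'rV[C]_n.+2) (Psi : endo_field M).
Variable (X : 'I_n -> field M).
Local Notation g := (pullback_form sigma).
Local Notation ds := (fun v => vder v sigma).
Hypothesis adm : is_admissible sigma.
Hypothesis LC : is_levi_civita g nabla.
Hypothesis oU : open U.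
Hypothesis normal : is_normal_field sigma U nu.
Hypothesis shape : is_shape_operator sigma U nu Psi.
Hypothesis frame : is_frame U X.
Hypothesis ortho : is_orthonormal g U X.
Implicit Types (p : M) (Y Z T V : field M).

Lemma vsmooth_sigma : vsmooth U sigma.
Proof. by case: adm => [[ss _ _] _]; exact: sub_vsmooth ss. Qed.

Lemma vsmooth_dsigma Y : smooth_field U Y ->
  vsmooth U (fun q => vder (Y q) sigma).
Proof. by move=> sY; apply: vsmooth_vder => //; exact: vsmooth_sigma. Qed.

Lemma csmooth_metric Y Z : smooth_field U Y -> smooth_field U Z ->
  csmooth U (fun q => g (Y q) (Z q)).
Proof. by case: adm => _ [_ _ _]; exact. Qed.

Lemma smooth_nabla Y Z : smooth_field U Y -> smooth_field U Z ->
  smooth_field U (fun q => nabla (Y q) Z).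
Proof. by case: LC => [[_ _ _]]; move=> + _ _; exact. Qed.

Lemma smooth_Psi Y : smooth_field U Y -> smooth_field U (fun q => Psi q (Y q)).
Proof. by move=> sY; case: shape => + _; exact. Qed.

Lemma metricC p (u v : CT p) : g u v = g v u.
Proof. exact: cdotC. Qed.

Lemma dsigma_inj p (u : CT p) : vder u sigma = 0 -> u = 0.
Proof.
case: adm => _ [_ _ nondeg _] u0; apply: nondeg => v.
by rewrite /pullback_form u0 -(scale0r (0 : 'rV__)) cdotZl mul0r.
Qed.

Lemma cdot_dsigma_sigma p (v : CT p) : U p ->
  cdot (vder v sigma) (sigma p) = 0.
Proof.
move=> Up; have := cder_cdot oU Up v vsmooth_sigma vsmooth_sigma.
have -> : (fun q => cdot (sigma q) (sigma q)) = fun=> -1.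
  by apply/funext => q; case: adm => [[_ qs _] _]; exact: qs.
rewrite (cder_cst oU Up) cdotC => /esym/eqP.
by rewrite -mulr2n mulrn_eq0 => /eqP.
Qed.

Lemma cdot_dsigma_nu p (v : CT p) : U p -> cdot (vder v sigma) (nu p) = 0.
Proof. by move=> Up; case: normal => _ /(_ p Up)[]. Qed.

Lemma cdot_nu p : U p -> cdot (nu p) (nu p) = 1.
Proof. by move=> Up; case: normal => _ /(_ p Up)[]. Qed.

Lemma cdot_sigma_nu p : U p -> cdot (sigma p) (nu p) = 0.
Proof. by move=> Up; case: normal => _ /(_ p Up)[]. Qed.

Lemma cdot_sigma p : cdot (sigma p) (sigma p) = -1.
Proof. by case: adm => [[_ qs _] _]; exact: qs. Qed.

Section FixedPoint.
Variable p : M.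
Hypothesis Up : U p.
Implicit Types (u v w : CT p).

(** Along [M], the ambient space splits orthogonally as the image of [dsigma],
    the normal line and the line of the position vector [sigma], on which the
    form is -1; [option (option 'I_n)] indexes the resulting basis. *)
Lemma adapted_basis_eq0 (w : 'rV[C]_n.+2) :
  (forall v, cdot w (vder v sigma) = 0) -> cdot w (nu p) = 0 ->
  cdot w (sigma p) = 0 -> w = 0.
Proof.
move=> wt wn ws.
pose b (k : option (option 'I_n)) := match k with
  | None => sigma p
  | Some None => nu p
  | Some (Some i) => vder (X i p) sigma
  end.
pose d (k : option (option 'I_n)) : C := if k is None then -1 else 1.
apply: (@cdot_orthobasis_eq0 _ _ _ b d).
- by rewrite !card_option card_ord.
- by case=> [?|] /=; rewrite ?oppr_eq0 oner_eq0.
- have O i j := ortho Up i j.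
  case=> [[i|]|] [[j|]|] //=; rewrite ?(cdotC (nu p) (vder _ _))
    ?(cdotC (sigma p) (vder _ _)) ?(cdotC (nu p) (sigma p)) ?cdot_dsigma_nu
    ?cdot_dsigma_sigma ?cdot_sigma_nu ?cdot_nu ?cdot_sigma//.
  by rewrite -[LHS]/(g (X i p) (X j p)) O !(inj_eq Some_inj); case: eqP.
- by case=> [[i|]|] //=.
Qed.

(** Uniqueness of the Levi-Civita connection: the tensor
    [B(Y, Z, T) = <D_Y (dsigma Z), dsigma T> - g(nabla_Y Z, T)] is symmetric in
    [Y, Z], both terms being torsion-free, and skew in [Z, T], both being metric.
    Alternating the two symmetries three times gives [B = - B]. *)
Lemma tangential_nabla Y Z T :
  smooth_field U Y -> smooth_field U Z -> smooth_field U T ->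
  cdot (vder (Y p) (fun q => vder (Z q) sigma)) (vder (T p) sigma) =
  g (nabla (Y p) Z) (T p).
Proof.
move=> sY sZ sT; have [_ tf mc] := LC.
pose B Y Z T :=
  cdot (vder (Y p) (fun q => vder (Z q) sigma)) (vder (T p) sigma) -
  g (nabla (Y p) Z) (T p).
have Bsym Y' Z' T' : smooth_field U Y' -> smooth_field U Z' ->
    B Y' Z' T' = B Z' Y' T'.
  move=> sY' sZ'.
  have := congr1 (fun e : 'rV_n.+2 => cdot e (vder (T' p) sigma))
    (vder_bracket oU Up sY' sZ' vsmooth_sigma).
  rewrite -(tf U Y' Z' p)// vderBl !cdotBl /B /pullback_form.
  set b := cdot _ _; set b' := cdot _ _; set a := cdot _ _; set a' := cdot _ _.
  move=> E; transitivity (a' - b' + ((a - a') - (b - b'))); first by ring.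
  by rewrite -E subrr addr0.
have Bskew Y' Z' T' : smooth_field U Y' -> smooth_field U Z' ->
    smooth_field U T' -> B Y' Z' T' = - B Y' T' Z'.
  move=> sY' sZ' sT'; apply/eqP; rewrite -subr_eq0 opprK; apply/eqP.
  have := mc p (Y' p) Z' T' (smooth_field_nearP oU Up sZ')
    (smooth_field_nearP oU Up sT').
  rewrite {1}/pullback_form.
  rewrite (cder_cdot oU Up _ (vsmooth_dsigma sZ') (vsmooth_dsigma sT')) => E.
  rewrite /B (metricC (nabla (Y' p) T')).
  rewrite (cdotC (vder (Y' p) _) (vder (Z' p) _)).
  by rewrite addrACA -opprD E subrr.
apply/eqP; rewrite -subr_eq0 -/(B Y Z T).
have E : B Y Z T = - B Y Z T.
  by rewrite {1}Bsym// Bskew// Bsym// Bskew// opprK Bsym// Bskew.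
by have /eqP := E; rewrite -subr_eq0 opprK -mulr2n mulrn_eq0.
Qed.

(** The flat derivative may replace the connection of the quadric, as they differ
    by a multiple of [sigma], which is orthogonal to [nu]. *)
Lemma normal_shape u Y : smooth_field U Y ->
  cdot (vder u (fun q => vder (Y q) sigma)) (nu p) = g (Psi p u) (Y p).
Proof.
move=> sY; case: shape => _ /(_ p Up u Y (smooth_field_nearP oU Up sY)) ->.
by rewrite /pullback_connection cdotDl cdotZl cdot_sigma_nu// mulr0 addr0.
Qed.

Lemma gauss_formula u Y : smooth_field U Y ->
  vder u (fun q => vder (Y q) sigma) =
  vder (nabla u Y) sigma + g (Psi p u) (Y p) *: nu p + g u (Y p) *: sigma p.
Proof.
move=> sY; apply/eqP; rewrite -subr_eq0; apply/eqP; apply: adapted_basis_eq0.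
- move=> v; have [V sV <-] := frame_extend v oU frame Up.
  have [Z sZ <-] := frame_extend u oU frame Up.
  rewrite cdotBl !cdotDl !cdotZl tangential_nabla//.
  rewrite (cdotC (nu p)) (cdotC (sigma p)) cdot_dsigma_nu// cdot_dsigma_sigma//.
  by rewrite !mulr0 !addr0 subrr.
- rewrite cdotBl !cdotDl !cdotZl normal_shape// cdot_dsigma_nu//.
  rewrite cdot_nu// cdot_sigma_nu//.
  by rewrite mulr0 mulr1 add0r addr0 subrr.
have E : cdot (vder u (fun q => vder (Y q) sigma)) (sigma p) = - g u (Y p).
  have := cder_cdot oU Up u (vsmooth_dsigma sY) vsmooth_sigma.
  have <- : cder u (fun=> 0) =
      cder u (fun q => cdot (vder (Y q) sigma) (sigma q)).
    apply: (cder_local oU Up); last exact: csmooth_cst.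
    by move=> q /set_mem Uq; rewrite cdot_dsigma_sigma.
  rewrite (cder_cst oU Up) (cdotC (vder (Y p) sigma)) => /esym/eqP.
  by rewrite addr_eq0 => /eqP.
rewrite cdotBl !cdotDl !cdotZl E cdot_dsigma_sigma// (cdotC (nu p)).
rewrite cdot_sigma_nu//.
by rewrite cdot_sigma; ring.
Qed.

(** The difference of the two sides is the [nu] component of
    [dsigma [Y, Z]], a tangent vector. *)
Lemma shape_selfadjoint u v : g (Psi p u) v = g u (Psi p v).
Proof.
have [Y sY <-] := frame_extend u oU frame Up.
have [Z sZ <-] := frame_extend v oU frame Up.
rewrite (metricC (Y p)) -!normal_shape//; apply/eqP.
rewrite -subr_eq0 -cdotBl -(vder_bracket oU Up sY sZ vsmooth_sigma).
by rewrite cdot_dsigma_nu.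
Qed.

(** The Weingarten formula, read off from the derivatives of the relations that
    define [nu]. *)
Lemma weingarten_formula v : vder v nu = - vder (Psi p v) sigma.
Proof.
have snu : vsmooth U nu by case: normal.
have dcst s t (c : C) : vsmooth U s -> vsmooth U t ->
    (forall q, U q -> cdot (s q) (t q) = c) ->
    cdot (vder v s) (t p) = - cdot (s p) (vder v t).
  move=> ss st stc; have := cder_cdot oU Up v ss st.
  have <- : cder v (fun=> c) = cder v (fun q => cdot (s q) (t q)).
    apply: (cder_local oU Up); last exact: csmooth_cst.
    by move=> q /set_mem Uq; rewrite stc.
  by rewrite (cder_cst oU Up) => /esym/eqP; rewrite addr_eq0 => /eqP.
apply/eqP; rewrite -addr_eq0; apply/eqP; apply: adapted_basis_eq0.
- move=> u; have [Y sY <-] := frame_extend u oU frame Up.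
  rewrite cdotDl (dcst _ _ 0 snu (vsmooth_dsigma sY)); last first.
    by move=> q Uq; rewrite cdotC cdot_dsigma_nu.
  by rewrite cdotC normal_shape// addNr.
- rewrite cdotDl cdot_dsigma_nu// addr0; have := dcst _ _ 1 snu snu (@cdot_nu).
  rewrite (cdotC (nu p)) => /eqP.
  by rewrite -addr_eq0 -mulr2n mulrn_eq0 => /eqP.
rewrite cdotDl cdot_dsigma_sigma// addr0 (dcst _ _ 0 snu vsmooth_sigma).
  by rewrite cdotC cdot_dsigma_nu// oppr0.
by move=> q Uq; rewrite cdotC cdot_sigma_nu.
Qed.

End FixedPoint.

(** Compare the second derivatives of [nu]: by the Weingarten formula they are
    derivatives of [- dsigma (Psi Y)], which the Gauss formula decomposes; the
    [nu] components cancel as [g] is symmetric, the [sigma] components as [Psi]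
    is self-adjoint. *)
Theorem codazzi_equation Y Z p : smooth_field U Y -> smooth_field U Z -> U p ->
  ext_cov_deriv nabla Psi Y Z p = 0.
Proof.
move=> sY sZ Up; have snu : vsmooth U nu by case: normal.
have dPsi V (v : CT p) : smooth_field U V -> vder v (fun q => vder (V q) nu) =
    - vder v (fun q => vder (Psi q (V q)) sigma).
  move=> sV; have s1 := csmooth_cst U (-1 : C).
  have sPV := vsmooth_dsigma (smooth_Psi sV).
  transitivity (vder v (fun q => (-1) *: vder (Psi q (V q)) sigma)).
    symmetry; apply: (vder_local oU Up); last exact: vsmoothZ.
    by move=> q /set_mem Uq; rewrite scaleN1r weingarten_formula.
  by rewrite (vderZ oU Up)// (cder_cst oU Up) scale0r add0r scaleN1r.
apply: dsigma_inj; rewrite /ext_cov_deriv !vderBl.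
have := vder_bracket oU Up sY sZ snu.
rewrite weingarten_formula// !dPsi// !gauss_formula//; try exact: smooth_Psi.
have sa : g (Y p) (Psi p (Z p)) = g (Z p) (Psi p (Y p)).
  by rewrite -shape_selfadjoint// metricC.
rewrite sa (metricC (Psi p (Z p)) (Psi p (Y p))).
set N := _ *: nu p; set S := _ *: sigma p; rewrite -!(addrA _ N S) => ->.
by rewrite opprK addrACA addKr opprD [_ + (- _ - _)]addrA subrr add0r addNr.
Qed.

(** When the Gauss formula for [Z] is differentiated, the functions multiplying
    [nu] and [sigma] are differentiated too, but those terms are orthogonal to
    [dsigma w]: only the derivatives of [nu] and [sigma] contribute. *)
Lemma tangential_second_derivative V Y Z p (w : CT p) :
  smooth_field U V -> smooth_field U Y -> smooth_field U Z -> U p ->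
  cdot (vder (V p) (fun q => vder (Y q) (fun r => vder (Z r) sigma)))
       (vder w sigma) =
  g (nabla (V p) (fun q => nabla (Y q) Z)) w
  - g (Psi p (Y p)) (Z p) * g (Psi p (V p)) w + g (Y p) (Z p) * g (V p) w.
Proof.
move=> sV sY sZ Up; have snu : vsmooth U nu by case: normal.
have sN := smooth_nabla sY sZ; have sP := smooth_Psi sY.
have sNv := vsmooth_dsigma sN.
have sPn := vsmoothZ oU (csmooth_metric sP sZ) snu.
have sYs := vsmoothZ oU (csmooth_metric sY sZ) vsmooth_sigma.
transitivity (cdot (vder (V p) (fun q => vder (nabla (Y q) Z) sigma +
    g (Psi q (Y q)) (Z q) *: nu q + g (Y q) (Z q) *: sigma q)) (vder w sigma)).
  congr (cdot _ _); apply: (vder_local oU Up); last first.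
    by apply: vsmooth_vder => //; exact: vsmooth_dsigma.
  by move=> q /set_mem Uq; rewrite gauss_formula.
rewrite !(vderD oU Up)//; last exact: vsmoothD.
rewrite !(vderZ oU Up)//; try exact: csmooth_metric; try exact: vsmooth_sigma.
rewrite gauss_formula// weingarten_formula//.
rewrite !cdotDl !cdotZl cdotNl (cdotC (nu p)) (cdotC (sigma p)).
rewrite cdot_dsigma_nu// cdot_dsigma_sigma// /pullback_form; ring.
Qed.

Theorem gauss_equation V Y Z T p : smooth_field U V -> smooth_field U Y ->
  smooth_field U Z -> smooth_field U T -> U p ->
  curvature4 g nabla V Y Z T p =
  g (Psi p (V p)) (Z p) * g (Psi p (Y p)) (T p)
  - g (Psi p (Y p)) (Z p) * g (Psi p (V p)) (T p)
  + g (Y p) (Z p) * g (V p) (T p) - g (V p) (Z p) * g (Y p) (T p).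
Proof.
move=> sV sY sZ sT Up; rewrite /curvature4 /curvature.
have := congr1 (fun e : 'rV_n.+2 => cdot e (vder (T p) sigma))
  (vder_bracket oU Up sV sY (vsmooth_dsigma sZ)).
rewrite gauss_formula// cdotBl !tangential_second_derivative//.
rewrite !cdotDl !cdotZl (cdotC (nu p)) (cdotC (sigma p)).
rewrite cdot_dsigma_nu// cdot_dsigma_sigma// !mulr0 !addr0.
rewrite -[cdot _ _]/(g (nabla (bracket V Y p) Z) (T p)) => E.
rewrite [g (_ - _ - _) _]/pullback_form !vderBl !cdotBl.
rewrite -![cdot _ _]/(g _ _) E; ring.
Qed.

End Hypersurface.

(** * Components in an orthonormal frame *)

Section Coframes.
Variables (R : realType) (n : nat) (M : manifold R n).
Variables (sigma : M -> 'rV[R[i]]_n.+2) (U : set M) (X : 'I_n -> field M).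
Local Notation g := (pullback_form sigma).
Hypothesis ortho : is_orthonormal g U X.

Lemma orthonormal_coord p (a : 'I_n -> R[i]) i : U p ->
  g (\sum_j a j *: X j p) (X i p) = a i.
Proof.
move=> Up; rewrite pullback_form_combl (bigD1 i)//= ortho// eqxx mulr1.
by rewrite big1 ?addr0// => j ji; rewrite ortho// (negPf ji) mulr0.
Qed.

Lemma coframe_metric theta p (v : CT p) i :
  is_frame U X -> is_coframe U X theta ->
  U p -> theta i p v = g (X i p) v.
Proof.
move=> [_ fr] co Up; have [a [-> _]] := fr p Up v.
rewrite [RHS]metricC orthonormal_coord// linear_sum.
rewrite (bigD1 i)//= linearZ/= co// eqxx mulr1.
rewrite big1 ?addr0// => j ji.
by rewrite linearZ/= co// eq_sym (negPf ji) mulr0.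
Qed.

Lemma decomposition_metric (Psi : endo_field M) Psic p (v : CT p) i :
  is_decomposition U X Psi Psic -> U p -> Psic i p v = g (Psi p v) (X i p).
Proof. by move=> dec Up; rewrite dec// orthonormal_coord. Qed.

End Coframes.

Theorem theorem6p3p1 (R : realType) (n : nat) (M : manifold R n)
    (sigma : M -> 'rV[R[i]]_n.+2) (nabla : connection M)
    (U : set M) (nu : M -> 'rV[R[i]]_n.+2) (Psi : endo_field M)
    (X : 'I_n -> field M) (theta Psic : 'I_n -> covector_field M) :
  is_admissible sigma ->
  is_levi_civita (pullback_form sigma) nabla ->
  open U ->
  is_normal_field sigma U nu ->
  is_shape_operator sigma U nu Psi ->
  is_frame U X ->
  is_orthonormal (pullback_form sigma) U X ->
  is_coframe U X theta ->
  is_decomposition U X Psi Psic ->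
  (forall Y Z : field M, smooth_field U Y -> smooth_field U Z ->
     forall p, U p -> ext_cov_deriv nabla Psi Y Z p = 0) /\
  (forall (i j : 'I_n) (Z W : field M), smooth_field U Z -> smooth_field U W ->
     forall p, U p ->
       curvature4 (pullback_form sigma) nabla (X i) (X j) Z W p
       - wedge (Psic i) (Psic j) Z W p
       = - wedge (theta i) (theta j) Z W p).
Proof.
move=> adm LC oU normal shape frame ortho co dec; split.
  move=> Y Z sY sZ p Up.
  exact: (codazzi_equation adm LC oU normal shape frame ortho).
move=> i j Z W sZ sW p Up; have [sX _] := frame.
rewrite (gauss_equation adm LC oU normal shape frame)// /wedge.
have th k v := coframe_metric ortho v k frame co Up.
have ps k v : Psic k p v = pullback_form sigma (Psi p (X k p)) v.
  rewrite (decomposition_metric ortho v k dec Up) metricC.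
  by rewrite (shape_selfadjoint adm oU normal shape frame).
by rewrite !th !ps; ring.
Qed.
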